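(* Let $F$ be a field with $\operatorname{char}F\ne2$. The following commutative $F$-algebras are $(2,3)$-palintropic: (i) any commutative algebra $A$ with $A^3=0$; (ii) any commutative power-associative algebra; (iii) any Jordan algebra (if $\operatorname{char}F$ is prime to $2$); (iv) any medial algebra; (v) any J-medial algebra; (vi) any commutative algebra satisfying $x^3(x^2y)-(x^2)^2(xy)=0$ for all $x,y$.
   Context: All algebras are commutative, not necessarily associative; the base field has characteristic different from $2$ throughout. A commutative algebra is $(2,3)$-palintropic if $(x^3)^2-(x^2)^3=0$ for all $x$, where $x^2=xx$, $x^3=x(xx)$, $(x^3)^2=x^3x^3$, $(x^2)^3=x^2(x^2x^2)$. $A^3=0$ means all products $x(yz)$ vanish. Power-associative: the subalgebra generated by any single element is associative. Jordan: commutative with $x^2(xy)=x(x^2y)$ for all $x,y$. Medial: commutative with $(xy)(zw)=(xz)(yw)$ for all $x,y,z,w$. J-medial: commutative with $(xy)(x^2z)=(x^2y)(xz)$ for all $x,y,z$. *)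

(* Defs.v *)
From mathcomp Require Import all_boot all_algebra.

Set Implicit Arguments.
Unset Strict Implicit.
Unset Printing Implicit Defensive.

Import GRing.Theory.
Local Open Scope ring_scope.

(* An F-algebra, not necessarily associative, unital or finite-dimensional, is
   an F-module A with a bilinear product mul; the classes of algebras below are
   meant for a commutative mul, which is a separate hypothesis. *)
Section CommutativeAlgebras.
Variables (F : fieldType) (A : lmodType F) (mul : {bilinear A -> A -> A}).
Implicit Types (x y z w : A) (S : A -> Prop).

Local Notation "x ** y" := (mul x y) (at level 40, left associativity).

Definition sq x : A := x ** x.
Definition cube x : A := x ** sq x.

Definition palintropic23 : Prop :=
  forall x, sq (cube x) - cube (sq x) = 0.

(* A^3 = 0 *)
Definition cube_zero : Prop := forall x y z, x ** (y ** z) = 0.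

Definition subalgebra S : Prop :=
  [/\ S 0,
      forall (a : F) x y, S x -> S y -> S (a *: x + y)
    & forall x y, S x -> S y -> S (x ** y)].

(* The intersection of all subalgebras containing x. *)
Definition generated x : A -> Prop :=
  fun y => forall S, subalgebra S -> S x -> S y.

Definition associative_on S : Prop :=
  forall x y z, S x -> S y -> S z -> x ** (y ** z) = (x ** y) ** z.

Definition power_associative : Prop :=
  forall x, associative_on (generated x).

Definition jordan : Prop :=
  forall x y, sq x ** (x ** y) = x ** (sq x ** y).

Definition medial : Prop :=
  forall x y z w, (x ** y) ** (z ** w) = (x ** z) ** (y ** w).

Definition J_medial : Prop :=
  forall x y z, (x ** y) ** (sq x ** z) = (sq x ** y) ** (x ** z).

Definition cube_sq_identity : Prop :=
  forall x y, cube x ** (sq x ** y) - sq (sq x) ** (x ** y) = 0.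

End CommutativeAlgebras.

(* Main.v *)
Require Import Defs.
From mathcomp Require Import all_boot all_algebra.

Import GRing.Theory.
Local Open Scope ring_scope.

(** In each class, [(x^3)^2] and [(x^2)^3] can be brought to a common form.
    When [A^3 = 0] both vanish.  For medial and J-medial algebras, and under
    [x^3 (x^2 y) = (x^2)^2 (x y)], one use of the identity, with powers of [x]
    for the other variables, turns one into the other.  In a power-associative
    algebra the factors of [(x x^2) (x x^2)] are regrouped inside the
    associative subalgebra generated by [x].

    Jordan algebras need more.  The identity [x^2 (x y) = x (x^2 y)] says that
    the multiplications by [x] and by [x^2] commute.  At [y = x] and [y = x^2]
    it yields [(x^2)^3 = x (x^2 x^3)], but it only rewrites products in which
    [x] or [x^2] is a factor, and [x^3 x^3] is not one of them.  That product
    appears once the identity is polarized in [x] ([jordan_polarized]): the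
    polarized identity at [z = y = x^2] gives [2 x^3 x^3 = 2 x (x^2 x^3)], and
    [2] is invertible. *)

Section Palintropic.
Variables (F : fieldType) (A : lmodType F) (mul : {bilinear A -> A -> A}).
Hypothesis mulC : commutative mul.
Implicit Types x y z u v p q : A.

Local Notation "x ** y" := (mul x y) (at level 40, left associativity).

Lemma cube_zero_palintropic : cube_zero mul -> palintropic23 mul.
Proof.
by move=> A3 x; rewrite /sq /cube /sq !A3 subrr.
Qed.

Lemma generated_mem x : generated mul x x.
Proof. by move=> S. Qed.

Lemma generated_mul x y z :
  generated mul x y -> generated mul x z -> generated mul x (y ** z).
Proof.
move=> gy gz S subS Sx; case: (subS) => _ _; apply; first exact: gy.
exact: gz.
Qed.

Lemma power_associative_palintropic :
  power_associative mul -> palintropic23 mul.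
Proof.
move=> pa x; apply/eqP; rewrite subr_eq0 /cube; apply/eqP.
have gx := generated_mem x.
have ga : generated mul x (sq mul x) by exact: generated_mul.
have gaa := generated_mul _ _ _ ga ga.
have gxa := generated_mul _ _ _ gx ga.
rewrite {1}/sq -(pa x _ _ _ gx ga gxa) (pa x _ _ _ ga gx ga).
by rewrite (mulC (sq mul x) x) -(pa x _ _ _ gx ga ga) (pa x _ _ _ gx gx gaa).
Qed.

Lemma medial_palintropic : medial mul -> palintropic23 mul.
Proof.
move=> med x; apply/eqP; rewrite subr_eq0; apply/eqP.
by rewrite {1}/sq /cube med.
Qed.

Lemma J_medial_palintropic : J_medial mul -> palintropic23 mul.
Proof.
move=> Jmed x; apply/eqP; rewrite subr_eq0; apply/eqP.
by rewrite {1}/sq /cube {2}(mulC x) Jmed mulC.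
Qed.

Lemma cube_sq_identity_palintropic :
  cube_sq_identity mul -> palintropic23 mul.
Proof.
move=> id32 x; have := id32 x x.
by rewrite (mulC (sq mul x) x) (mulC (sq mul (sq mul x))).
Qed.

(** The part of [(u + v)(p + q)] that is odd in [(v, q)], isolated by
    replacing [v] and [q] with their opposites. *)
Lemma mul_odd_part u v p q :
  (u + v) ** (p + q) - (u - v) ** (p - q) = (u ** q + v ** p) *+ 2.
Proof.
have expand v' q' :
    (u + v') ** (p + q') = u ** p + v' ** q' + (u ** q' + v' ** p).
  by rewrite linearDl !linearDr /= (addrC (v' ** p)) addrACA.
rewrite !expand !linearNr !linearNl /= opprK -opprD opprB.
by rewrite addrC addrA subrK -mulr2n.
Qed.

Hypothesis charF : 2%N \notin [pchar F].

Lemma mulr2n_inj : injective (fun v => v *+ 2).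
Proof.
have nz2 : 2%:R != 0 :> F by move: charF; rewrite inE.
by move=> u v; rewrite -!(scaler_nat 2) => /(scalerI nz2).
Qed.

(** The component of [x^2 (x y) = x (x^2 y)] that is linear in the increment
    [z] of [x].  Subtracting the identity at [x - z] from the identity at
    [x + z] leaves twice the components of odd degree in [z], and the cubic
    one is the identity at [z] itself, so no further division is needed. *)
Lemma jordan_polarized x y z : jordan mul ->
  sq mul x ** (z ** y) + ((x ** z) ** (x ** y)) *+ 2
  = z ** (sq mul x ** y) + (x ** ((x ** z) ** y)) *+ 2.
Proof.
move=> jor.
(* S and D are the parts of (x + z)^2 that are even and odd in z. *)
pose S := sq mul x + sq mul z.
pose D := (x ** z) *+ 2.
have sqD v : sq mul (x + v) = sq mul x + sq mul v + (x ** v) *+ 2.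
  rewrite /sq linearDl !linearDr /= (mulC v x) mulr2n.
  by rewrite (addrC (x ** v) (v ** v)) addrACA.
have sqB : sq mul (x - z) = S - D.
  by rewrite sqD /sq !linearNr linearNl /= opprK mulNrn.
have odd : S ** (z ** y) + D ** (x ** y) = x ** (D ** y) + z ** (S ** y).
  apply: mulr2n_inj; rewrite -!mul_odd_part.
  have ED u v : u ** y + v ** y = (u + v) ** y by rewrite linearDl.
  have EB u v : u ** y - v ** y = (u - v) ** y by rewrite linearBl.
  by rewrite !ED !EB -[S + D]sqD -sqB !jor.
move: odd; rewrite /S /D !linearDl !linearDr /= jor -!mulr2n.
by rewrite addrAC [X in _ = X -> _]addrA => /addIr ->; rewrite addrC.
Qed.

Lemma jordan_palintropic : jordan mul -> palintropic23 mul.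
Proof.
move=> jor x; apply/eqP; rewrite subr_eq0; apply/eqP.
have /addrI/mulr2n_inj pol := jordan_polarized x (sq mul x) (sq mul x) jor.
have -> : sq mul (cube mul x) = x ** (cube mul x ** sq mul x) by exact: pol.
have aa : sq mul (sq mul x) = x ** (sq mul x ** x) by exact: jor.
rewrite /cube aa jor (mulC x (sq mul x)).
by rewrite (mulC (sq mul x ** x)).
Qed.

End Palintropic.

Theorem proposition1p4 (F : fieldType) (charF : 2%N \notin [pchar F])
    (A : lmodType F) (mul : {bilinear A -> A -> A}) (mulC : commutative mul) :
  (cube_zero mul -> palintropic23 mul) /\
  (power_associative mul -> palintropic23 mul) /\
  (jordan mul -> palintropic23 mul) /\
  (medial mul -> palintropic23 mul) /\
  (J_medial mul -> palintropic23 mul) /\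
  (cube_sq_identity mul -> palintropic23 mul).
Proof.
split; first exact: cube_zero_palintropic.
split; first exact: power_associative_palintropic.
split; first exact: jordan_palintropic.
split; first exact: medial_palintropic.
split; first exact: J_medial_palintropic.
exact: cube_sq_identity_palintropic.
Qed.
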